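(* Let $\tau$ be a relational vocabulary whose relation symbols are at most binary. For every formula $\phi\in \mathsf{D}^2(\tau)$ there is a formula $\phi^*\in \mathsf{IF}^2(\tau)$ such that for all $\tau$-structures $\mathfrak{A}$ and all teams $X$ of $\mathfrak{A}$ with $\mathrm{dom}(X)=\{x,y\}$, $$\mathfrak{A}\models_X\phi \iff \mathfrak{A}\models_X\phi^*.$$
   Context: Syntax. Fix two variables $x,y$. Formulas of $\mathsf{D}^2(\tau)$ (two-variable dependence logic) are generated by $\phi::= t_1=t_2\mid R(t_1,\dots,t_n)\mid \neg t_1=t_2\mid \neg R(t_1,\dots,t_n)\mid =\!(t_1,t_2)\mid \neg =\!(t_1,t_2)\mid =\!(t_1)\mid\neg =\!(t_1)\mid(\phi\wedge\phi)\mid(\phi\vee\phi)\mid\forall x\phi\mid\forall y\phi\mid\exists x\phi\mid\exists y\phi$. Formulas of $\mathsf{IF}^2(\tau)$ (two-variable independence-friendly logic) are generated by $\phi::= t_1=t_2\mid R(t_1,\dots,t_n)\mid \neg t_1=t_2\mid \neg R(t_1,\dots,t_n)\mid(\phi\wedge\phi)\mid(\phi\vee\phi)\mid\forall x\phi\mid\forall y\phi\mid\exists x/W\phi\mid\exists y/W\phi$. Here $R\in\tau$ is $n$-ary, $t_1,\dots,t_n\in\{x,y\}$ and $W\subseteq\{x,y\}$; $\exists x/\emptyset\,\phi$ is identified with $\exists x\phi$. Teams. A team $X$ of $\mathfrak{A}$ (domain $A$) with domain $\mathrm{dom}(X)=\{x_1,\dots,x_k\}$ is any set of assignments $\{x_1,\dots,x_k\}\to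 A$. The assignment $s(a/x)$ has domain $\mathrm{dom}(s)\cup\{x\}$, maps $x$ to $a$ and agrees with $s$ elsewhere. For $F\colon X\to A$, $X(F/x)=\{s(F(s)/x)\mid s\in X\}$, and $X(A/x)=\{s(a/x)\mid s\in X,a\in A\}$. For $W\subseteq\mathrm{dom}(X)$, $F\colon X\to A$ is $W$-independent if $F(s)=F(s')$ whenever $s,s'\in X$ agree on $\mathrm{dom}(X)\setminus W$. Semantics. (1) For a first-order literal $\phi$: $\mathfrak{A}\models_X\phi$ iff every $s\in X$ satisfies $\phi$ in $\mathfrak{A}$ in the usual sense. (2) $\mathfrak{A}\models_X\psi\wedge\phi$ iff $\mathfrak{A}\models_X\psi$ and $\mathfrak{A}\models_X\phi$. (3) $\mathfrak{A}\models_X\psi\vee\phi$ iff $X=Y\cup Z$ for some teams $Y,Z$ with $\mathfrak{A}\models_Y\psi$ and $\mathfrak{A}\models_Z\phi$. (4) $\mathfrak{A}\models_X\exists v\psi$ iff $\mathfrak{A}\models_{X(F/v)}\psi$ for some $F\colon X\to A$. (5) $\mathfrak{A}\models_X\forall v\psi$ iff $\mathfrak{A}\models_{X(A/v)}\psi$. (6) $\mathfrak{A}\models_X\exists v/W\psi$ iff $\mathfrak{A}\models_{X(F/v)}\psi$ for some $W$-independent $F\colon X\to A$. (7) $\mathfrak{A}\models_X{=}(t_1,\dots,t_n)$ iff any $s,s'\in X$ that give equal values to each of $t_1,\dots,t_{n-1}$ give equal values to $t_n$. (8) $\mathfrak{A}\models_X\neg{=}(t_1,\dots,t_n)$ iff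 $X=\emptyset$. *)

(* Defs.v *)
From HB Require Import structures.
From mathcomp Require Import all_boot.
From mathcomp Require Import boolp classical_sets.

Set Implicit Arguments.
Unset Strict Implicit.
Unset Printing Implicit Defensive.

Local Open Scope classical_set_scope.

Inductive var := vx | vy.

Definition bool_of_var (v : var) : bool := if v is vx then true else false.
Definition var_of_bool (b : bool) : var := if b then vx else vy.

Lemma bool_of_varK : cancel bool_of_var var_of_bool.
Proof. by case. Qed.

HB.instance Definition _ := Countable.copy var (can_type bool_of_varK).
HB.instance Definition _ : isFinite var := CanIsFinite bool_of_varK.

Record vocabulary := Vocabulary {
  symbol :> Type;
  arity : symbol -> nat
}.

Record structure (tau : vocabulary) := Structure {
  carrier :> Type;
  interp : forall R : tau, (arity R).-tuple carrier -> Prop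
}.

(* First-order literals, the common atomic part of the two logics. *)
Inductive literal (tau : vocabulary) :=
| Eq (t1 t2 : var)
| Rel (R : tau) (ts : (arity R).-tuple var)
| NEq (t1 t2 : var)
| NRel (R : tau) (ts : (arity R).-tuple var).

Inductive D2 (tau : vocabulary) :=
| DLit (l : literal tau)
| DDep (t1 t2 : var)
| DNDep (t1 t2 : var)
| DConst (t : var)
| DNConst (t : var)
| DAnd (phi psi : D2 tau)
| DOr (phi psi : D2 tau)
| DAll (v : var) (phi : D2 tau)
| DEx (v : var) (phi : D2 tau).

(* [IEx v W phi] is the slashed quantifier "exists v/W, phi"; the plain
   "exists v, phi" is the case [W = set0]. *)
Inductive IF2 (tau : vocabulary) :=
| ILit (l : literal tau)
| IAnd (phi psi : IF2 tau)
| IOr (phi psi : IF2 tau)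
| IAll (v : var) (phi : IF2 tau)
| IEx (v : var) (W : {set var}) (phi : IF2 tau).

(* As [var] has exactly two elements, total functions on [var] are the
   assignments of domain {x, y}; both kinds of update preserve that domain. *)
Definition assignment (A : Type) := var -> A.
Notation team A := (set (assignment A)).

Definition update (A : Type) (s : assignment A) (v : var) (a : A) :
    assignment A :=
  fun u => if u == v then a else s u.

(* X(F/v), for F defined on the members of X only. *)
Definition supplement (A : Type) (X : team A) (v : var) (F : X -> A) : team A :=
  range (fun s : X => update (val s) v (F s)).

(* X(A/v) *)
Definition duplicate (A : Type) (X : team A) (v : var) : team A :=
  [set update s v a | s in X & a in [set: A]].

Definition independent (A : Type) (X : team A) (W : {set var}) (F : X -> A) :=
  forall s s' : X,
    (forall u, u \notin W -> val s u = val s' u) -> F s = F s'.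

Definition lit_holds (tau : vocabulary) (M : structure tau) (s : assignment M)
    (l : literal tau) : Prop :=
  match l with
  | Eq t1 t2 => s t1 = s t2
  | Rel R ts => interp (map_tuple s ts)
  | NEq t1 t2 => s t1 <> s t2
  | NRel R ts => ~ interp (map_tuple s ts)
  end.

Definition lit_sat (tau : vocabulary) (M : structure tau) (X : team M)
    (l : literal tau) : Prop :=
  forall s, X s -> lit_holds s l.

(* =(t_1, ..., t_n) with [ts] = t_1, ..., t_(n-1) and [t] = t_n. *)
Definition dep_sat (A : Type) (X : team A) (ts : seq var) (t : var) : Prop :=
  forall s s', X s -> X s' -> (forall u, u \in ts -> s u = s' u) -> s t = s' t.

Fixpoint D2_sat (tau : vocabulary) (M : structure tau) (X : team M)
    (phi : D2 tau) : Prop :=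
  match phi with
  | DLit l => lit_sat X l
  | DDep t1 t2 => dep_sat X [:: t1] t2
  | DNDep _ _ => X = set0
  | DConst t => dep_sat X [::] t
  | DNConst _ => X = set0
  | DAnd psi1 psi2 => D2_sat X psi1 /\ D2_sat X psi2
  | DOr psi1 psi2 =>
      exists Y Z : team M, [/\ X = Y `|` Z, D2_sat Y psi1 & D2_sat Z psi2]
  | DAll v psi => D2_sat (duplicate X v) psi
  | DEx v psi => exists F : X -> M, D2_sat (supplement v F) psi
  end.

Fixpoint IF2_sat (tau : vocabulary) (M : structure tau) (X : team M)
    (phi : IF2 tau) : Prop :=
  match phi with
  | ILit l => lit_sat X l
  | IAnd psi1 psi2 => IF2_sat X psi1 /\ IF2_sat X psi2
  | IOr psi1 psi2 =>
      exists Y Z : team M, [/\ X = Y `|` Z, IF2_sat Y psi1 & IF2_sat Z psi2]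
  | IAll v psi => IF2_sat (duplicate X v) psi
  | IEx v W psi =>
      exists2 F : X -> M, independent W F & IF2_sat (supplement v F) psi
  end.

(* Main.v *)
Require Import Defs.
From mathcomp Require Import boolp classical_sets.
From mathcomp Require Import all_boot.

(** A dependence atom says that the value of [t] is a function of certain other
    values. The slashed quantifier [exists v/W] picks a value that may depend
    only on the variables outside [W], so [exists v/W, v = t] says that [t] is
    determined by these variables. Overwriting [v], even when it is itself the
    determining variable, is harmless because [v] is only needed for the choice
    of the value. *)

Definition other (v : var) : var := if v is vx then vy else vx.

Lemma other_neq v : v != other v.
Proof. by case: v. Qed.

(** As [t != v], updating [v] leaves [t] alone, so the equation forces the chosen value to be [s t];
    independence of this only candidate is the stated condition. *)
Lemma sat_IEx_eq (tau : vocabulary) (M : structure tau) (X : team M)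
    (v t : var) (W : {set var}) : t != v ->
  IF2_sat X (@IEx tau v W (ILit (Eq tau v t))) <->
  (forall s s', X s -> X s' -> (forall u, u \notin W -> s u = s' u) ->
     s t = s' t).
Proof.
move=> /negPf t_neq_v; split=> [[F indF satF] s s' Xs Xs' ss' | detX].
  have value (r : X) : F r = val r t.
    have /= := satF _ (ex_intro2 _ _ r Logic.I erefl).
    by rewrite /update eqxx t_neq_v.
  pose r := SigSub (mem_set Xs) : X; pose r' := SigSub (mem_set Xs') : X.
  by rewrite -[s]/(val r) -[s']/(val r') -!value; apply: indF.
exists (fun r : X => val r t) => [r r' rr' | _ [r _ <-] /=].
  by apply: detX rr'; apply: set_mem; apply: valP.
by rewrite /update eqxx t_neq_v.
Qed.

(** Assignments that agree outside the empty set are equal. *)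
Lemma independent_set0 (A : Type) (X : team A) (F : X -> A) :
  independent finset.set0 F.
Proof.
move=> s s' ss'; congr F; apply: val_inj; apply: funext => u.
by apply: ss'; rewrite finset.inE.
Qed.

Lemma sat_NEq_refl (tau : vocabulary) (M : structure tau) (X : team M) t :
  X = classical_sets.set0 <-> IF2_sat X (ILit (NEq tau t t)).
Proof.
split=> [-> // | satX].
by rewrite -classical_sets.subset0 => s Xs; apply: (satX s Xs).
Qed.

(** When [t1 == t2] the dependence atom is trivial and becomes a tautology, as [sat_IEx_eq] needs
    distinct variables. Negated atoms become an unsatisfiable literal, true only in the empty
    team. *)
Fixpoint translate {tau : vocabulary} (phi : D2 tau) : IF2 tau :=
  match phi with
  | DLit l => ILit l
  | DDep t1 t2 =>
      if t1 == t2 then ILit (Eq tau t1 t1)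
      else IEx t1 (finset.setC (finset.set1 t1)) (ILit (Eq tau t1 t2))
  | DNDep t _ | DNConst t => ILit (NEq tau t t)
  | DConst t => IEx (other t) (finset.setTfor var) (ILit (Eq tau (other t) t))
  | DAnd psi1 psi2 => IAnd (translate psi1) (translate psi2)
  | DOr psi1 psi2 => IOr (translate psi1) (translate psi2)
  | DAll v psi => IAll v (translate psi)
  | DEx v psi => IEx v finset.set0 (translate psi)
  end.

Lemma translateP (tau : vocabulary) (M : structure tau) (phi : D2 tau)
    (X : team M) :
  D2_sat X phi <-> IF2_sat X (translate phi).
Proof.
(* The team stays general, since disjunctions and quantifiers change it. *)
elim: phi X => [l|t1 t2|t1 t2|t|t|psi1 IH1 psi2 IH2|psi1 IH1 psi2 IH2
               |v psi IH|v psi IH] X //; rewrite [translate _]/=.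
- case: eqVneq => [<-|t12].
    by split=> // _ s s' _ _; apply; rewrite mem_seq1.
  rewrite sat_IEx_eq 1?eq_sym //.
  split=> detX s s' Xs Xs' ss'; apply: detX => // u.
    by rewrite mem_seq1 => ut1; apply: ss'; rewrite !finset.inE negbK.
  by rewrite !finset.inE negbK => ut1; apply: ss'; rewrite mem_seq1.
- exact: sat_NEq_refl.
- rewrite sat_IEx_eq ?other_neq //.
  split=> detX s s' Xs Xs' _; apply: detX => // u.
  by rewrite finset.inE.
- exact: sat_NEq_refl.
- by rewrite /= IH1 IH2.
- by split=> -[Y [Z [XYZ /IH1 satY /IH2 satZ]]]; exists Y, Z.
- exact: IH.
- split=> [[F /IH satF] | [F _ /IH satF]]; exists F => //.
  exact: independent_set0.
Qed.

Theorem lemma3p1 (tau : vocabulary) (htau : forall R : tau, arity R <= 2)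
    (phi : D2 tau) :
  exists phi' : IF2 tau, forall (M : structure tau) (X : team M),
    D2_sat X phi <-> IF2_sat X phi'.
Proof. by exists (translate phi) => M X; apply: translateP. Qed.
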